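(* Let $Q=Q^\top\in\mathbb{R}^{n\times n}$ be positive semidefinite and $R=R^\top\in\mathbb{R}^{m\times m}$ be positive definite. Then the data $(U_-,X)$ are informative for linear quadratic regulation if and only if at least one of the following two conditions holds: (i) The data $(U_-,X)$ are informative for system identification (i.e. $\Sigma_{i/s}=\{(A_s,B_s)\}$); equivalently, there exists $\begin{bmatrix}V_1 & V_2\end{bmatrix}$ such that $$\begin{bmatrix}X_- \\ U_- \end{bmatrix}\begin{bmatrix}V_1 & V_2\end{bmatrix}=\begin{bmatrix}I & 0 \\ 0 & I\end{bmatrix}.$$ Moreover, the linear quadratic regulator problem is solvable for $(A_s,B_s,Q,R)$, where $A_s=X_+V_1$ and $B_s=X_+V_2$. (ii) There exists $\Theta\in\mathbb{R}^{T\times n}$ such that $X_-\Theta=(X_-\Theta)^\top$, $U_-\Theta=0$, $$\begin{bmatrix}X_-\Theta & X_+\Theta \\ \Theta^\top X_+^\top & X_-\Theta\end{bmatrix}>0,$$ and $QX_+\Theta=0$.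
   Context: Fix positive integers $n,m,q,T_1,\dots,T_q$ and put $T=T_1+\cdots+T_q$. Let $(A_s,B_s)\in\mathbb{R}^{n\times n}\times\mathbb{R}^{n\times m}$ be the 'true' system $x(t+1)=A_sx(t)+B_su(t)$. For $i=1,\dots,q$ let $u^i(0),\dots,u^i(T_i-1)\in\mathbb{R}^m$ and $x^i(0),\dots,x^i(T_i)\in\mathbb{R}^n$ be input/state data generated by this system, i.e. $x^i(t+1)=A_sx^i(t)+B_su^i(t)$ for $t=0,\dots,T_i-1$. Put $U^i_-=[u^i(0)\ \cdots\ u^i(T_i-1)]$, $X^i=[x^i(0)\ \cdots\ x^i(T_i)]$, $X^i_-=[x^i(0)\ \cdots\ x^i(T_i-1)]$, $X^i_+=[x^i(1)\ \cdots\ x^i(T_i)]$, and $U_-=[U^1_-\ \cdots\ U^q_-]$, $X=[X^1\ \cdots\ X^q]$, $X_-=[X^1_-\ \cdots\ X^q_-]$, $X_+=[X^1_+\ \cdots\ X^q_+]$; thus $X_+=A_sX_-+B_sU_-$ and $U_-,X_-,X_+$ have $T$ columns. The set of systems consistent with the data is $$\Sigma_{i/s}=\Big\{(A,B)\in\mathbb{R}^{n\times n}\times\mathbb{R}^{n\times m}\ \Big|\ X_+=\begin{bmatrix}A & B\end{bmatrix}\begin{bmatrix}X_- \\ U_- \end{bmatrix}\Big\}.$$ For a symmetric matrix, $>0$ means positive definite. LQR. For a system $x(t+1)=Ax(t)+Bu(t)$, let $x_{x_0,u}$ be the state sequence with $x(0)=x_0$ and input $u$, and let $J(x_0,u)=\sum_{t=0}^\infty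 x(t)^\top Qx(t)+u(t)^\top Ru(t)$. The LQR problem is solvable for $(A,B,Q,R)$ if for every $x_0$ there is an input $u^*$ with $J(x_0,u^* )<\infty$, $\lim_{t\to\infty}x_{x_0,u^*}(t)=0$, and $J(x_0,u^* )\le J(x_0,\bar u)$ for all $\bar u$ with $\lim_{t\to\infty}x_{x_0,\bar u}(t)=0$. Known facts (discrete-time LQR theory): if $(A,B)$ is stabilizable, the discrete-time algebraic Riccati equation $P=A^\top PA-A^\top PB(R+B^\top PB)^{-1}B^\top PA+Q$ has a unique largest real symmetric solution $P^+$ (i.e. $P^+\ge P$ for every real symmetric solution $P$), and $P^+\geq 0$; the LQR problem is solvable if and only if $(A,B)$ is stabilizable and every eigenvalue $\lambda$ of $A$ on the unit circle is $(Q,A)$-observable, i.e. $\operatorname{rank}\begin{bmatrix}A-\lambda I \\ Q \end{bmatrix}=n$; in that case the optimal input is unique for every $x_0$ and generated by $u=Kx$ with $K=-(R+B^\top P^+B)^{-1}B^\top P^+A$, and $A+BK$ is stable (all eigenvalues in the open unit disk). This $K$ is called the optimal feedback gain for $(A,B,Q,R)$. Define $\Sigma_K^{Q,R}=\{(A,B)\mid$ the LQR problem is solvable for $(A,B,Q,R)$ and $K$ is the optimal feedback gain for $(A,B,Q,R)\}$. The data $(U_-,X)$ are informative for linear quadratic regulation (for given $Q,R$) if there exists $K$ with $\Sigma_{i/s}\subseteq\Sigma_K^{Q,R}$. *)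

(* Defs.v *)
From HB Require Import structures.
From mathcomp Require Import all_boot all_order all_algebra.
From mathcomp Require Import all_classical all_reals all_analysis.

Set Implicit Arguments.
Unset Strict Implicit.
Unset Printing Implicit Defensive.

Import Order.TTheory GRing.Theory Num.Theory.
Import numFieldNormedType.Exports.

Local Open Scope classical_set_scope.
Local Open Scope ring_scope.

(* The base field is F : realType; Q and R always denote the LQR weights. *)

Definition posdefmx (F : realType) (k : nat) (M : 'M[F]_k) : Prop :=
  M^T = M /\ forall v : 'cV[F]_k, v != 0 -> 0 < (v^T *m M *m v) 0 0.

Definition possemidefmx (F : realType) (k : nat) (M : 'M[F]_k) : Prop :=
  M^T = M /\ forall v : 'cV[F]_k, 0 <= (v^T *m M *m v) 0 0.

(* Trajectory i consists of the inputs u i 0, ..., u i (Ts i - 1) and the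
   states x i 0, ..., x i (Ts i); for t : 'I_(Ts i), the state indices t and
   t + 1 in 'I_(Ts i).+1 are widen_ord (leqnSn _) t and lift ord0 t. *)
Section Data.
Variables (F : realType) (n m q : nat) (Ts : 'I_q -> nat).
Variable u : forall i : 'I_q, 'I_(Ts i) -> 'cV[F]_m.
Variable x : forall i : 'I_q, 'I_(Ts i).+1 -> 'cV[F]_n.

Definition data_generated_by (A : 'M[F]_n) (B : 'M[F]_(n, m)) : Prop :=
  forall (i : 'I_q) (t : 'I_(Ts i)),
    x (lift ord0 t) = A *m x (widen_ord (leqnSn (Ts i)) t) + B *m u t.

Definition Uminus : 'M[F]_(m, \sum_(i < q) Ts i) :=
  \mxrow_(i < q) \matrix_(k < m, t < Ts i) u t k 0.

Definition Xminus : 'M[F]_(n, \sum_(i < q) Ts i) :=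
  \mxrow_(i < q)
    \matrix_(k < n, t < Ts i) x (widen_ord (leqnSn (Ts i)) t) k 0.

Definition Xplus : 'M[F]_(n, \sum_(i < q) Ts i) :=
  \mxrow_(i < q) \matrix_(k < n, t < Ts i) x (lift ord0 t) k 0.

Definition Sigma_is : set ('M[F]_n * 'M[F]_(n, m)) :=
  [set AB | Xplus = row_mx AB.1 AB.2 *m col_mx Xminus Uminus].

Definition informative_sysid (As : 'M[F]_n) (Bs : 'M[F]_(n, m)) : Prop :=
  Sigma_is = [set (As, Bs)].

End Data.

Section LQR.
Variables (F : realType) (n m : nat).
Variables (A : 'M[F]_n) (B : 'M[F]_(n, m)) (Q : 'M[F]_n) (R : 'M[F]_m).

Fixpoint state_seq (x0 : 'cV[F]_n) (u : nat -> 'cV[F]_m) (t : nat) :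
    'cV[F]_n :=
  if t is s.+1 then A *m state_seq x0 u s + B *m u s else x0.

Definition stage_cost (x : 'cV[F]_n) (v : 'cV[F]_m) : F :=
  (x^T *m Q *m x + v^T *m R *m v) 0 0.

Definition lqr_cost (x0 : 'cV[F]_n) (u : nat -> 'cV[F]_m) : \bar F :=
  (\sum_(0 <= t <oo) (stage_cost (state_seq x0 u t) (u t))%:E)%E.

Definition lqr_solvable : Prop :=
  forall x0 : 'cV[F]_n, exists ustar : nat -> 'cV[F]_m,
    [/\ (lqr_cost x0 ustar < +oo)%E,
        state_seq x0 ustar @ \oo --> (0 : 'cV[F]_n)
      & forall ubar : nat -> 'cV[F]_m,
          state_seq x0 ubar @ \oo --> (0 : 'cV[F]_n) ->
          (lqr_cost x0 ustar <= lqr_cost x0 ubar)%E].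

(* invmx is the identity on singular matrices, so the existence of the inverse
   occurring in the Riccati equation has to be part of being a solution. *)
Definition dare_solution (P : 'M[F]_n) : Prop :=
  [/\ P^T = P,
      R + B^T *m P *m B \in unitmx
    & P = A^T *m P *m A
          - A^T *m P *m B *m invmx (R + B^T *m P *m B) *m B^T *m P *m A + Q].

Definition dare_largest_solution (P : 'M[F]_n) : Prop :=
  dare_solution P /\
  forall P' : 'M[F]_n, dare_solution P' -> possemidefmx (P - P').

Definition optimal_feedback_gain (K : 'M[F]_(m, n)) : Prop :=
  exists P : 'M[F]_n,
    dare_largest_solution P /\
    K = - (invmx (R + B^T *m P *m B) *m B^T *m P *m A).

End LQR.

Definition Sigma_K (F : realType) (n m : nat) (Q : 'M[F]_n) (R : 'M[F]_m)
    (K : 'M[F]_(m, n)) : set ('M[F]_n * 'M[F]_(n, m)) :=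
  [set AB | lqr_solvable AB.1 AB.2 Q R /\
            optimal_feedback_gain AB.1 AB.2 Q R K].

Definition informative_lqr (F : realType) (n m q : nat) (Ts : 'I_q -> nat)
    (u : forall i : 'I_q, 'I_(Ts i) -> 'cV[F]_m)
    (x : forall i : 'I_q, 'I_(Ts i).+1 -> 'cV[F]_n)
    (Q : 'M[F]_n) (R : 'M[F]_m) : Prop :=
  exists K : 'M[F]_(m, n), Sigma_is u x `<=` Sigma_K Q R K.

(* Main.v *)
Require Import Defs.
From HB Require Import structures.
From mathcomp Require Import all_boot all_order all_algebra.
From mathcomp Require Import all_classical all_reals all_analysis.
From mathcomp Require Import ring lra.

Set Implicit Arguments.
Unset Strict Implicit.
Unset Printing Implicit Defensive.

Import Order.TTheory GRing.Theory Num.Theory.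
Import numFieldNormedType.Exports.

Local Open Scope classical_set_scope.
Local Open Scope ring_scope.

(* If [a b] annihilates [X_-; U_-], then (As + e a, Bs + e b) is consistent with
   the data for every column e.  A common stabilizing gain K forces a + b K = 0,
   since otherwise e can be chosen to give the closed loop the eigenvalue 2.
   Hence all these systems share one closed loop M, thus one Riccati solution P,
   and stationarity R K + B^T P M = 0 for B = Bs + e b gives b^T e^T P M = 0 for
   all e.  If [a b] <> 0 then b <> 0, so P M = 0, K = 0, P = Q and Q As = 0 with
   As stable; condition (ii) is then the Lyapunov inequality for As.

   That LQR solvability yields a largest Riccati solution is proved from the
   value function: by the parallelogram law for the cost and strict convexity,
   optimal inputs are unique and linear in the initial state, so they are a
   stabilizing feedback and the value is a quadratic form solving the equation.
   It dominates every other solution P' because R + B^T P' B >= 0. *)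

(** * Bilinear and quadratic forms, positive definiteness *)

Section QuadraticForm.
Variable F : realType.

Definition bf k l (M : 'M[F]_(k, l)) (v : 'cV[F]_k) (w : 'cV[F]_l) : F :=
  (v^T *m M *m w) 0 0.

Definition qf k (M : 'M[F]_k) (v : 'cV[F]_k) : F := bf M v v.

Lemma bfE k l (M : 'M[F]_(k, l)) v w :
  bf M v w = \sum_i \sum_j v i 0 * M i j * w j 0.
Proof.
rewrite /bf mxE exchange_big; apply: eq_bigr => j _.
by rewrite mxE big_distrl; apply: eq_bigr => i _; rewrite mxE.
Qed.

Lemma bf_tr k l (M : 'M[F]_(k, l)) v w : bf M^T w v = bf M v w.
Proof.
transitivity ((v^T *m M *m w)^T 0 0); last by rewrite mxE.
by rewrite !trmx_mul trmxK mulmxA.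
Qed.

Lemma bfDl k l (M : 'M[F]_(k, l)) v1 v2 w :
  bf M (v1 + v2) w = bf M v1 w + bf M v2 w.
Proof. by rewrite /bf linearD !mulmxDl mxE. Qed.

Lemma bfDr k l (M : 'M[F]_(k, l)) v w1 w2 :
  bf M v (w1 + w2) = bf M v w1 + bf M v w2.
Proof. by rewrite /bf mulmxDr mxE. Qed.

Lemma bfZl k l (M : 'M[F]_(k, l)) c v w : bf M (c *: v) w = c * bf M v w.
Proof. by rewrite /bf linearZ /= -!scalemxAl mxE. Qed.

Lemma bfZr k l (M : 'M[F]_(k, l)) c v w : bf M v (c *: w) = c * bf M v w.
Proof. by rewrite /bf -!scalemxAr mxE. Qed.

Lemma bfNr k l (M : 'M[F]_(k, l)) v w : bf M v (- w) = - bf M v w.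
Proof. by rewrite -scaleN1r bfZr mulN1r. Qed.

Lemma bfMD k l (M N : 'M[F]_(k, l)) v w : bf (M + N) v w = bf M v w + bf N v w.
Proof. by rewrite /bf mulmxDr mulmxDl mxE. Qed.

Lemma bfMN k l (M : 'M[F]_(k, l)) v w : bf (- M) v w = - bf M v w.
Proof. by rewrite /bf mulmxN mulNmx mxE. Qed.

Lemma bf0 k l v w : bf (0 : 'M[F]_(k, l)) v w = 0.
Proof. by rewrite /bf mulmx0 mul0mx mxE. Qed.

Lemma bf_mul k l p r (M : 'M[F]_(k, l)) (C : 'M[F]_(k, p)) (D : 'M[F]_(l, r))
    v w :
  bf M (C *m v) (D *m w) = bf (C^T *m M *m D) v w.
Proof. by rewrite /bf trmx_mul !mulmxA. Qed.

Lemma bf_mulr k l r (M : 'M[F]_(k, l)) (D : 'M[F]_(l, r)) v w :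
  bf M v (D *m w) = bf (M *m D) v w.
Proof. by rewrite /bf !mulmxA. Qed.

Lemma bf_delta k l (M : 'M[F]_(k, l)) i j :
  bf M (delta_mx i 0) (delta_mx j 0) = M i j.
Proof. by rewrite /bf trmx_delta -rowE -colE !mxE. Qed.

Lemma qf_mul k l (M : 'M[F]_k) (C : 'M[F]_(k, l)) v :
  qf M (C *m v) = qf (C^T *m M *m C) v.
Proof. exact: bf_mul. Qed.

Lemma qfMD k (M N : 'M[F]_k) v : qf (M + N) v = qf M v + qf N v.
Proof. exact: bfMD. Qed.

Lemma qfMB k (M N : 'M[F]_k) v : qf (M - N) v = qf M v - qf N v.
Proof. by rewrite /qf bfMD bfMN. Qed.

Lemma qfZ k (M : 'M[F]_k) c v : qf M (c *: v) = c ^+ 2 * qf M v.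
Proof. by rewrite /qf bfZl bfZr mulrA expr2. Qed.

Lemma qfN k (M : 'M[F]_k) v : qf M (- v) = qf M v.
Proof. by rewrite -scaleN1r qfZ sqrrN expr1n mul1r. Qed.

Lemma qf0 k (M : 'M[F]_k) : qf M 0 = 0.
Proof. by rewrite -[0](scale0r 0) qfZ expr0n mul0r. Qed.

Lemma qfD k (M : 'M[F]_k) v w :
  M^T = M -> qf M (v + w) = qf M v + bf M v w *+ 2 + qf M w.
Proof.
move=> symM; rewrite /qf !bfDl !bfDr -[bf M w v]bf_tr symM mulr2n.
by rewrite !addrA.
Qed.

Lemma qf_parallelogram k (M : 'M[F]_k) v w :
  qf M (v + w) + qf M (v - w) = (qf M v + qf M v) + (qf M w + qf M w).
Proof.
by rewrite -[- w]scaleN1r /qf !bfDl !bfDr !bfZl !bfZr; ring.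
Qed.

(** Polarization: for a symmetric matrix the values of the form at [e_i], [e_j] and [e_i + e_j]
    determine the entry [(i, j)]. *)
Lemma sym_qf_eq k (M N : 'M[F]_k) :
  M^T = M -> N^T = N -> qf M =1 qf N -> M = N.
Proof.
move=> symM symN eqMN; apply/matrixP => i j; rewrite -!bf_delta.
have := eqMN (delta_mx i 0 + delta_mx j 0).
by rewrite !qfD // !eqMN => /addIr/addrI; lra.
Qed.

Lemma qf1E k (v : 'cV[F]_k) : qf 1%:M v = \sum_i v i 0 ^+ 2.
Proof.
by rewrite /qf /bf mulmx1 mxE; apply: eq_bigr => i _; rewrite mxE expr2.
Qed.

Lemma qf1_ge0 k (v : 'cV[F]_k) : 0 <= qf 1%:M v.
Proof. by rewrite qf1E sumr_ge0 // => i _; exact: sqr_ge0. Qed.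

Lemma qf1_coord_le k (v : 'cV[F]_k) i : v i 0 ^+ 2 <= qf 1%:M v.
Proof.
by rewrite qf1E (bigD1 i) //= lerDl sumr_ge0 // => j _; rewrite sqr_ge0.
Qed.

Lemma qf1_eq0 k (v : 'cV[F]_k) : qf 1%:M v = 0 -> v = 0.
Proof.
move=> v0; apply/matrixP => i j; rewrite ord1 mxE; apply/eqP.
by rewrite -sqrf_eq0 eq_le sqr_ge0 -v0 qf1_coord_le.
Qed.

Lemma qf1_gt0 k (v : 'cV[F]_k) : v != 0 -> 0 < qf 1%:M v.
Proof.
move=> v0; rewrite lt_neqAle eq_sym; apply/andP; split.
  by apply: contraNneq v0 => /qf1_eq0 ->.
exact: qf1_ge0.
Qed.

Lemma posdef_eq0 k (M : 'M[F]_k) v : posdefmx M -> qf M v <= 0 -> v = 0.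
Proof.
move=> [_ pM] le0; apply/eqP; apply: contraTT le0 => /pM.
by rewrite -ltNge.
Qed.

Lemma posdef_ge0 k (M : 'M[F]_k) v : posdefmx M -> 0 <= qf M v.
Proof.
by move=> [_ pM]; have [->|/pM/ltW //] := eqVneq v 0; rewrite qf0.
Qed.

Lemma posdef_semi k (M : 'M[F]_k) : posdefmx M -> possemidefmx M.
Proof. by move=> pM; split=> [|v]; [case: pM | exact: posdef_ge0]. Qed.

Lemma possemidef_antisym k (M N : 'M[F]_k) :
  possemidefmx (M - N) -> possemidefmx (N - M) -> M^T = M -> N^T = N -> M = N.
Proof.
move=> [_ p1] [_ p2] sM sN; apply: sym_qf_eq => // v.
have := p1 v; have := p2 v; rewrite -!/(bf _ _ _) -!/(qf _ _) !qfMB => *; lra.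
Qed.

Lemma posdef_unit k (M : 'M[F]_k) : posdefmx M -> M \in unitmx.
Proof.
move=> pM; rewrite -unitmx_tr -row_free_unit; apply/inj_row_free => r rM0.
apply/trmx_inj; rewrite trmx0; apply: (posdef_eq0 pM).
rewrite /qf /bf -mulmxA trmxK.
suff -> : M *m r^T = 0 by rewrite mulmx0 mxE.
by rewrite -[M]trmxK -trmx_mul rM0 trmx0.
Qed.

Lemma sym_invmx k (M : 'M[F]_k) : M^T = M -> (invmx M)^T = invmx M.
Proof. by move=> symM; rewrite trmx_inv symM. Qed.

(** The polynomial [t |-> qf M (t *: v + w)] is nonnegative, so its discriminant is nonpositive; if
    its leading coefficient vanishes, so must the linear one. *)
Lemma psd_cauchy k (M : 'M[F]_k) v w : possemidefmx M ->
  bf M v w ^+ 2 <= qf M v * qf M w.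
Proof.
move=> [symM pM].
have disc (t : F) : 0 <= qf M v * t ^+ 2 + (bf M v w *+ 2) * t + qf M w.
  have := pM (t *: v + w); rewrite -/(bf _ _ _) -/(qf _ _) qfD // qfZ bfZl.
  by rewrite mulr2n; congr (0 <= _); rewrite mulr2n; ring.
have [v0|vn0] := eqVneq (qf M v) 0.
  rewrite v0 mul0r.
  have [->|bn0] := eqVneq (bf M v w) 0; first by rewrite expr0n.
  (* At this [t] the function, now affine, would take the value [-1]. *)
  have := disc (- (qf M w + 1) / (bf M v w *+ 2)).
  by rewrite v0 mul0r add0r mulrC divfK ?mulrn_eq0 // => ?; lra.
have vp : 0 < qf M v by rewrite lt_neqAle eq_sym vn0; exact: pM.
have := disc (- bf M v w / qf M v).
have -> : qf M v * (- bf M v w / qf M v) ^+ 2 +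
   bf M v w *+ 2 * (- bf M v w / qf M v) + qf M w =
   (qf M v * qf M w - bf M v w ^+ 2) / qf M v by rewrite mulr2n; field.
by rewrite pmulr_lge0 ?invr_gt0 // subr_ge0.
Qed.

(* Cauchy-Schwarz for the inner product of M, against the vector M^-1 e_i. *)
Lemma posdef_coord_le k (M : 'M[F]_k) (i : 'I_k) :
  posdefmx M -> exists C : F, forall v : 'cV[F]_k, v i 0 ^+ 2 <= C * qf M v.
Proof.
move=> pM; exists (qf M (invmx M *m delta_mx i 0)) => v.
have := psd_cauchy (invmx M *m delta_mx i 0) v (posdef_semi pM).
have [symM _] := pM.
rewrite {1}/bf trmx_mul sym_invmx // trmx_delta mulmxKV ?posdef_unit //.
by rewrite -rowE mxE.
Qed.

End QuadraticForm.

(** * Entrywise limits and stable matrices *)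

Section Convergence.
Variable F : realType.

Lemma cvg_mxP k l (f : nat -> 'M[F]_(k, l)) (M : 'M[F]_(k, l)) :
  f @ \oo --> M <-> forall i j, f t i j @[t --> \oo] --> M i j.
Proof.
split=> [fM i j|fM].
  by apply: (@continuous_cvg _ _ _ _ _ f (fun N : 'M[F]_(k, l) => N i j) M) fM;
    exact: coord_continuous.
apply/cvgrPdist_lt => e e0 /=.
have near_all : \forall t \near \oo, forall i, forall j, `|M i j - f t i j| < e.
  by apply: filter_forall => i; apply: filter_forall => j;
    have /cvgrPdist_lt/(_ _ e0) := fM i j.
near=> t; rewrite [ltLHS]mx_normrE; apply/bigmax_ltP; split => // -[i j] _ /=.
rewrite !mxE; move: i j; near: t; exact: near_all.
Unshelve. all: by end_near. Qed.

Lemma cvg_sum_fin I (r : seq I) (f : I -> nat -> F) (a : I -> F) :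
  (forall i, f i t @[t --> \oo] --> a i) ->
  \sum_(i <- r) f i t @[t --> \oo] --> \sum_(i <- r) a i.
Proof.
move=> fa; elim: r => [|i r IH].
  rewrite big_nil (_ : (fun t => _) = cst 0); first exact: cvg_cst.
  by apply/funext => t; rewrite big_nil.
rewrite big_cons (_ : (fun t => _) = f i \+ (fun t => \sum_(j <- r) f j t)).
  exact: cvgD.
by apply/funext => t; rewrite big_cons.
Qed.

Lemma cvg_bf k (M : nat -> 'M[F]_k) (N : 'M[F]_k)
    (f g : nat -> 'cV[F]_k) (v w : 'cV[F]_k) :
  M @ \oo --> N -> f @ \oo --> v -> g @ \oo --> w ->
  bf (M t) (f t) (g t) @[t --> \oo] --> bf N v w.
Proof.
move=> /cvg_mxP MN /cvg_mxP fv /cvg_mxP gw.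
rewrite bfE (_ : (fun t => _) =
  fun t => \sum_i \sum_j f t i 0 * M t i j * g t j 0); last first.
  by apply/funext => t; rewrite bfE.
by apply: cvg_sum_fin => i; apply: cvg_sum_fin => j; do 2?apply: cvgM.
Qed.

Lemma cvg_qf0 k (M : 'M[F]_k) (f : nat -> 'cV[F]_k) :
  f @ \oo --> (0 : 'cV[F]_k) -> qf M (f t) @[t --> \oo] --> (0 : F).
Proof.
by move=> f0; rewrite -(qf0 M); apply: cvg_bf => //; exact: cvg_cst.
Qed.

(** By [posdef_coord_le], every squared coordinate is squeezed between 0 and a multiple of the
    form. *)
Lemma posdef_cvg0 k (M : 'M[F]_k) (f : nat -> 'cV[F]_k) :
  posdefmx M -> qf M (f t) @[t --> \oo] --> (0 : F) ->
  f @ \oo --> (0 : 'cV[F]_k).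
Proof.
move=> pM qf0; apply/cvg_mxP => i j; rewrite ord1 mxE.
have [C leC] := posdef_coord_le i pM.
have sq0 : (f t i 0) ^+ 2 @[t --> \oo] --> (0 : F).
  have C0 : C * qf M (f t) @[t --> \oo] --> (0 : F).
    by rewrite -[X in _ --> X](mulr0 C); apply: cvgMl_tmp.
  apply: (squeeze_cvgr _ (cvg_cst _) C0).
  by near=> t; rewrite sqr_ge0 leC.
have: Num.sqrt (f t i 0 ^+ 2) @[t --> \oo] --> (0 : F).
  by rewrite -sqrtr0; apply: continuous_cvg => //; exact: sqrt_continuous.
by under eq_fun do rewrite sqrtr_sqr; move/norm_cvg0P.
Unshelve. all: by end_near. Qed.

(** Decay of all free trajectories replaces the condition on eigenvalues, which need not lie in the
    real field [F]. *)
Definition stable n (A : 'M[F]_n) : Prop :=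
  forall x : 'cV[F]_n, A ^+ t *m x @[t --> \oo] --> (0 : 'cV[F]_n).

Lemma trmx_exp n (A : 'M[F]_n) t : (A ^+ t)^T = A^T ^+ t.
Proof.
elim: t => [|t IH]; first by rewrite !expr0 trmx1.
by rewrite exprS exprSr -IH -!mulmxE trmx_mul.
Qed.

Lemma stableP n (A : 'M[F]_n) :
  stable A <-> (fun t => A ^+ t) @ \oo --> (0 : 'M[F]_n).
Proof.
split=> [stA|/cvg_mxP A0 x].
  apply/cvg_mxP => i j; have /cvg_mxP/(_ i 0) := stA (delta_mx j 0).
  by rewrite !mxE; under eq_fun do rewrite -colE mxE.
apply/cvg_mxP => i j; rewrite mxE.
rewrite (_ : (fun t => _) = fun t => \sum_h (A ^+ t) i h * x h j); last first.
  by apply/funext => t; rewrite mxE.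
rewrite [X in _ --> X](_ : 0 = \sum_(h < n) 0 * x h j); last first.
  by rewrite big1 // => h; rewrite mul0r.
apply: cvg_sum_fin => h; apply: cvgMr_tmp.
by have := A0 i h; rewrite mxE.
Qed.

(** Decay of trajectories is not visibly invariant under transposition, but by [stableP] it is
    entrywise convergence of the powers, which is. *)
Lemma stable_tr n (A : 'M[F]_n) : stable A -> stable A^T.
Proof.
move=> /stableP/cvg_mxP stA; apply/stableP/cvg_mxP => i j.
have := stA j i; rewrite !mxE.
by under [in X in _ -> X]eq_fun do rewrite -trmx_exp mxE.
Qed.

Lemma unstable_double n (A : 'M[F]_n) (v : 'cV[F]_n) :
  stable A -> A *m v = v *+ 2 -> v = 0.
Proof.
move=> stA Av; apply/matrixP => i j; rewrite ord1 mxE; apply/eqP.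
have pow t : A ^+ t *m v = 2 ^+ t *: v.
  elim: t => [|t IH]; first by rewrite !expr0 mul1mx scale1r.
  by rewrite exprS -mulmxE -mulmxA IH -scalemxAr Av exprSr -scalerA scaler_nat.
apply: contraT => vi0; exfalso.
have /cvg_mxP/(_ i 0) := stA v; rewrite mxE => /cvgrPdist_lt.
move=> /(_ `|v i 0|); rewrite normr_gt0 => /(_ vi0) [N _ /(_ N (leqnn N))] /=.
rewrite pow mxE sub0r normrN normrM ltNge => /negP; apply.
by rewrite ler_peMl // normrX normr_nat exprn_ege1 // ler1n.
Qed.

(** The form is constant along trajectories that tend to 0. Applied to the difference of two
    solutions of one Lyapunov equation, this gives their equality. *)
Lemma stable_invariant_qf n (A D : 'M[F]_n) :
  stable A -> (forall x, qf D (A *m x) = qf D x) -> qf D =1 fun=> 0.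
Proof.
move=> stA inv x; have pow t : qf D (A ^+ t *m x) = qf D x.
  elim: t => [|t <-]; first by rewrite expr0 mul1mx.
  by rewrite exprS -mulmxE -mulmxA inv.
have := cvg_qf0 D (stA x).
rewrite (_ : (fun t => _) = cst (qf D x)); last first.
  by apply/funext => t; rewrite pow.
by move=> /(cvg_lim (@Rhausdorff F)) <-; rewrite lim_cst //; exact: Rhausdorff.
Qed.

End Convergence.

(** * Avoiding roots of polynomials, and an invertible resolvent *)

Section NonRoots.
Variable F : realType.

(** Roots are split off one at a time: once [X - f k0] is factored out, injectivity of [f] keeps it
    from vanishing at any [f k] with [k > k0]. *)
Lemma eventually_not_root (f : nat -> F) (p : {poly F}) :
  injective f -> p != 0 ->
  exists N, forall k, (N <= k)%N -> ~~ root p (f k).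
Proof.
move=> injf; elim: (size p).+1 {-2}p (ltnSn (size p)) => // d IH {}p size_p p0.
have [[k0 rk0]|noroot] := pselect (exists k, root p (f k)); last first.
  by exists 0%N => k _; apply/negP => rk; apply: noroot; exists k.
have [q pE] := factor_theorem _ _ rk0.
have q0 : q != 0 by apply: contraNneq p0 => q0; rewrite pE q0 mul0r.
have [|N nroot] := IH q _ q0.
  by move: size_p; rewrite pE size_Mmonic ?monicXsubC // size_XsubC addn2.
exists (maxn N k0.+1) => k; rewrite geq_max => /andP[Nk k0k].
rewrite pE rootM negb_or nroot //= root_XsubC.
by apply: contraTneq k0k => /injf ->; rewrite ltnn.
Qed.

(* With z = c + is on the unit circle, this is (M - z)(M - z^* ) invertible;
   factoring instead at real pairs z, 1/z shows that the determinant is not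
   identically zero as a polynomial in c. *)
Lemma unit_circle_resolvent n (M : 'M[F]_n) :
  exists2 c : F, `|c| <= 1 & M *m M - (c *+ 2) *: M + 1%:M \in unitmx.
Proof.
pose p := \det (map_mx polyC (M *m M + 1%:M) - ('X *+ 2) *: map_mx polyC M).
have pE c : p.[c] = \det (M *m M - (c *+ 2) *: M + 1%:M).
  rewrite -/(horner_eval c p) -det_map_mx; congr (\det _).
  apply/matrixP => i j; rewrite !mxE /= /horner_eval !hornerE.
  by rewrite addrAC.
(* The two sequences are reciprocal, which supplies the pairs [z], [1/z]. Since [g] has values in
   [[0, 1]], the final [c] is taken from it as well. *)
pose f k : F := k.+1%:R; pose g k : F := k.+1%:R^-1.
have injf : injective f by move=> k l /eqP; rewrite eqr_nat => /eqP[].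
have injg : injective g by move=> k l /invr_inj/injf.
have chi0 : char_poly M != 0 by rewrite monic_neq0 ?char_poly_monic.
have resolvent z : ~~ root (char_poly M) z -> M - z%:M \in unitmx.
  rewrite -eigenvalue_root_char /eigenvalue /eigenspace negbK.
  by rewrite kermx_eq0 row_free_unit.
have p0 : p != 0.
  have [N1 n1] := eventually_not_root injf chi0.
  have [N2 n2] := eventually_not_root injg chi0.
  have := resolvent _ (n1 _ (leq_maxl N1 N2)).
  have := resolvent _ (n2 _ (leq_maxr N1 N2)).
  set z := f _; set z' := g _ => u2 u1.
  have zz' : z * z' = 1 by rewrite divff // pnatr_eq0.
  apply/eqP => pz; have := pE ((z + z') / 2); rewrite pz horner0.
  suff -> : M *m M - ((z + z') / 2 *+ 2) *: M + 1%:M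
            = (M - z%:M) *m (M - z'%:M).
    move/esym/eqP; apply/negP; rewrite -unitfE -unitmxE.
    by rewrite unitmx_mul u1 u2.
  rewrite -mulr_natr divfK ?pnatr_eq0 // mulmxBr !mulmxBl.
  rewrite mul_mx_scalar mul_scalar_mx -scalar_mxM zz' scalerDl.
  by rewrite opprB opprD !addrA [LHS]addrAC.
have [N nN] := eventually_not_root injg p0.
exists (g N); last by rewrite unitmxE unitfE -pE; exact: nN.
by rewrite ger0_norm ?invr_ge0 ?ler0n // invf_le1 ?ltr0n // ler1n.
Qed.

End NonRoots.

(** * The Riccati equation and completion of squares *)

Section Riccati.
Variables (F : realType) (n m : nat).
Variables (A : 'M[F]_n) (B : 'M[F]_(n, m)) (Q : 'M[F]_n) (R : 'M[F]_m).
Hypotheses (hQ : possemidefmx Q) (hR : posdefmx R).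
Implicit Types (P : 'M[F]_n) (x : 'cV[F]_n) (v : 'cV[F]_m).

Definition riccati_weight P := R + B^T *m P *m B.

Definition riccati_gain P := - (invmx (riccati_weight P) *m B^T *m P *m A).

Definition riccati_map P :=
  A^T *m P *m A
  - A^T *m P *m B *m invmx (riccati_weight P) *m B^T *m P *m A + Q.

Lemma stage_costE x v : stage_cost Q R x v = qf Q x + qf R v.
Proof. by rewrite /stage_cost mxE. Qed.

Lemma stage_cost_ge0 x v : 0 <= stage_cost Q R x v.
Proof.
rewrite stage_costE addr_ge0 ?[0 <= qf R v]posdef_ge0 //.
by case: hQ => _; apply.
Qed.

Lemma riccati_weight_sym P : P^T = P -> (riccati_weight P)^T = riccati_weight P.
Proof.
move=> symP; case: hR => symR _.
by rewrite /riccati_weight linearD /= symR !trmx_mul trmxK symP mulmxA.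
Qed.

Lemma riccati_weight_posdef P :
  possemidefmx P -> posdefmx (riccati_weight P).
Proof.
move=> [symP P0]; split; first exact: riccati_weight_sym.
move=> v v0; rewrite -/(bf _ _ _) -/(qf _ _) qfMD -qf_mul ltr_pwDl //.
  by case: hR => _; apply.
exact: P0.
Qed.

(** For symmetric [P] this is the stationarity condition for minimizing [stage_cost Q R x v + qf P
    (A *m x + B *m v)] over [v]. Written through the closed loop, it can be subtracted between
    systems that share one. *)
Lemma riccati_gain_foc P : riccati_weight P \in unitmx ->
  R *m riccati_gain P + B^T *m P *m (A + B *m riccati_gain P) = 0.
Proof.
move=> uS; rewrite mulmxDr addrCA mulmxA -mulmxDl.
rewrite -/(riccati_weight P) /riccati_gain mulmxN -!mulmxA.
rewrite (mulmxA (riccati_weight P)).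
by rewrite mulmxV // mul1mx subrr.
Qed.

Lemma riccati_map_sym P : P^T = P -> (riccati_map P)^T = riccati_map P.
Proof.
move=> symP; case: hQ => symQ _; rewrite /riccati_map !linearD linearN /=.
rewrite !trmx_mul !trmxK symP symQ.
by rewrite (sym_invmx (riccati_weight_sym symP)) !mulmxA.
Qed.

(** [P] may be indefinite here, so that the identity applies to every Riccati solution and not only
    to the value function. *)
Lemma complete_square P x v : P^T = P -> riccati_weight P \in unitmx ->
  stage_cost Q R x v + qf P (A *m x + B *m v) =
  qf (riccati_map P) x + qf (riccati_weight P) (v - riccati_gain P *m x).
Proof.
move=> symP uS; have symS := riccati_weight_sym symP.
have symSi := sym_invmx symS.
rewrite stage_costE !qfD // /riccati_gain mulNmx opprK.
set S := riccati_weight P in uS symS symSi *.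
have -> : qf P (B *m v) = qf S v - qf R v.
  by rewrite qf_mul /S /riccati_weight qfMD addrC addKr.
have -> : bf S v (invmx S *m B^T *m P *m A *m x) = bf P (A *m x) (B *m v).
  rewrite [LHS]bf_mulr !mulmxA mulmxV // mul1mx -[RHS]bf_tr symP.
  by rewrite bf_mul.
have -> : qf S (invmx S *m B^T *m P *m A *m x) =
    qf (A^T *m P *m B *m invmx S *m B^T *m P *m A) x.
  rewrite qf_mul !trmx_mul trmxK symP symSi -!mulmxA.
  by rewrite (mulmxA S) mulmxV // mul1mx.
rewrite /riccati_map -/S [qf (_ + Q) x]qfMD qfMB -qf_mul; ring.
Qed.

Lemma dare_solutionE P : dare_solution A B Q R P <->
  [/\ P^T = P, riccati_weight P \in unitmx & P = riccati_map P].
Proof. by []. Qed.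

(* Evaluated along x_t = z^t (a + ib) with |z| = 1, v_t = K x_t + z^t w, the
   completed square has no net change of x^* P x, so that w^* S w equals a
   stage cost. *)
Lemma dare_weight_ge0 P w : dare_solution A B Q R P ->
  0 <= qf (riccati_weight P) w.
Proof.
move=> /dare_solutionE[symP uS ric].
set K := riccati_gain P; set M := A + B *m K.
have [c c1 uD] := unit_circle_resolvent M.
set D := _ + 1%:M in uD.
pose s := Num.sqrt (1 - c ^+ 2).
have cs : c ^+ 2 + s ^+ 2 = 1.
  rewrite sqr_sqrtr ?subrKC // subr_ge0 -[_ ^+ 2]ger0_norm ?sqr_ge0 //.
  by rewrite normrX exprn_ile1.
pose y := - (invmx D *m (B *m w)).
pose b := s *: y; pose a := M *m y - c *: y.
have Dy : M *m (M *m y) - (c *+ 2) *: (M *m y) + y = - (B *m w).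
  have Dt : D *m (invmx D *m (B *m w)) = B *m w.
    by rewrite mulmxA mulmxV ?mul1mx.
  rewrite -Dt /y; move: (invmx D *m _) => t.
  rewrite /D mulmxDl mulmxBl mul1mx -scalemxAl -mulmxA !mulmxN scalerN.
  by rewrite !opprD.
have nexta : A *m a + B *m (K *m a + w) = c *: a - s *: b.
  have s2 : s ^+ 2 = 1 - c ^+ 2 by rewrite -cs addrAC subrr add0r.
  rewrite [B *m (_ + w)]mulmxDr.
  have -> : B *m w = - (M *m (M *m y) - (c *+ 2) *: (M *m y) + y).
    by rewrite Dy opprK.
  rewrite addrA (mulmxA B) -mulmxDl -/M /a /b mulmxBr -scalemxAr !scalerA.
  rewrite -expr2 s2.
  move: (M *m (M *m y)) (M *m y) => t u.
  by apply/matrixP => i j; rewrite !mxE; ring.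
have nextb : A *m b + B *m (K *m b) = s *: a + c *: b.
  rewrite (mulmxA B) -mulmxDl -/M /a /b scalerBr !scalerA (mulrC s c) subrK.
  by rewrite scalemxAr.
clearbody a b.
have sqa := complete_square a (K *m a + w) symP uS.
have sqb := complete_square b (K *m b) symP uS.
have := addr_ge0 (stage_cost_ge0 a (K *m a + w)) (stage_cost_ge0 b (K *m b)).
have rot : qf P (c *: a - s *: b) + qf P (s *: a + c *: b) = qf P a + qf P b.
  rewrite -[RHS]mul1r -cs -[- (s *: b)]scaleNr !qfD // !qfZ !bfZl !bfZr.
  rewrite !mulr2n; ring.
move: sqa sqb; rewrite nexta nextb -ric addrAC subrr add0r subrr qf0 addr0.
lra.
Qed.

End Riccati.

(** * Trajectories, costs and their lower bound by Riccati solutions *)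

Section Cost.
Variables (F : realType) (n m : nat).
Variables (A : 'M[F]_n) (B : 'M[F]_(n, m)) (Q : 'M[F]_n) (R : 'M[F]_m).
Hypotheses (hQ : possemidefmx Q) (hR : posdefmx R).
Implicit Types (P : 'M[F]_n) (x y : 'cV[F]_n) (v w : nat -> 'cV[F]_m).

Local Notation state := (state_seq A B).
Local Notation cost := (lqr_cost A B Q R).
Local Notation admissible x u := (state x u @ \oo --> (0 : 'cV[F]_n)).

Lemma stateD x y v w t :
  state (x + y) (v \+ w) t = state x v t + state y w t.
Proof. by elim: t => //= t ->; rewrite !mulmxDr addrACA. Qed.

Lemma stateZ c x v t : state (c *: x) (c \*: v) t = c *: state x v t.
Proof. by elim: t => //= t ->; rewrite -!scalemxAr scalerDr. Qed.

Lemma stateB x y v w t :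
  state (x - y) (v \- w) t = state x v t - state y w t.
Proof. by elim: t => //= t ->; rewrite !mulmxBr opprD addrACA. Qed.

Lemma state_shift x v t :
  state x v t.+1 = state (A *m x + B *m v 0%N) (fun s => v s.+1) t.
Proof. by elim: t => //= t <-. Qed.

Lemma admissibleD x y v w :
  admissible x v -> admissible y w -> admissible (x + y) (v \+ w).
Proof.
move=> xv yw; rewrite -[0]addr0.
by rewrite (_ : state _ _ = state x v \+ state y w);
  [exact: cvgD | apply/funext => t; exact: stateD].
Qed.

Lemma admissibleZ c x v : admissible x v -> admissible (c *: x) (c \*: v).
Proof.
move=> xv; rewrite -[0](scaler0 _ c).
by rewrite (_ : state _ _ = c \*: state x v);
  [exact: cvgZl_tmp | apply/funext => t; exact: stateZ].
Qed.

Lemma admissibleB x y v w :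
  admissible x v -> admissible y w -> admissible (x - y) (v \- w).
Proof.
move=> xv yw; rewrite -[0]subr0.
by rewrite (_ : state _ _ = state x v \- state y w);
  [exact: cvgB | apply/funext => t; exact: stateB].
Qed.

Lemma admissible_shift x v : admissible x v <->
  admissible (A *m x + B *m v 0%N) (fun s => v s.+1).
Proof.
rewrite -(cvg_shiftS (state x v)).
by rewrite (_ : [sequence _]_n = state (A *m x + B *m v 0%N) (fun s => v s.+1));
  [| apply/funext => t; rewrite /= -state_shift].
Qed.

Lemma cost_ge0 x v : (0 <= cost x v)%E.
Proof.
by apply: nneseries_ge0 => t _ _; rewrite lee_fin; exact: stage_cost_ge0.
Qed.

Lemma partial_cost_le x v N :
  ((\sum_(t < N) stage_cost Q R (state x v t) (v t))%:E <= cost x v)%E.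
Proof.
rewrite -(big_mkord xpredT (fun t => stage_cost Q R (state x v t) (v t))).
rewrite -sumEFin; apply: nneseries_lim_ge => t _ _.
by rewrite lee_fin; exact: stage_cost_ge0.
Qed.

Lemma cost_cvg x v c : cost x v = c%:E ->
  \sum_(t < N) stage_cost Q R (state x v t) (v t) @[N --> \oo] --> c.
Proof.
move=> xvc; pose f t := (stage_cost Q R (state x v t) (v t))%:E.
have f0 t : (0 <= t)%N -> true -> (0 <= f t)%E.
  by move=> _ _; rewrite lee_fin; exact: stage_cost_ge0.
have : (\sum_(0 <= t < N) f t)%E @[N --> \oo] --> c%:E.
  have cv := @is_cvg_nneseries _ f xpredT 0%N f0; rewrite -xvc; exact: cv.
move=> /fine_cvg; under eq_fun do rewrite /= sumEFin /= big_mkord.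
exact.
Qed.

(** The identity holds stage by stage. It is stated without subtracting costs, so it covers infinite
    ones; uniqueness and additivity of optimal inputs come from it. *)
Lemma cost_parallelogram x y v w :
  (cost (x + y)%R (v \+ w)%R + cost (x - y)%R (v \- w)%R =
   (cost x v + cost x v) + (cost y w + cost y w))%E.
Proof.
rewrite /lqr_cost -!nneseriesD; do ?[move=> t _ _]; last first.
all: rewrite ?adde_ge0 ?lee_fin ?stage_cost_ge0 //.
apply: eq_eseriesr => t _; rewrite -!EFinD; congr (_%:E).
rewrite (stateD x y v w) (stateB x y v w) !stage_costE /= addrACA.
rewrite !qf_parallelogram.
by ring.
Qed.

Lemma cost_scale c x v : cost (c *: x) (c \*: v) = ((c ^+ 2)%:E * cost x v)%E.
Proof.
rewrite /lqr_cost -nneseriesZl; last first.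
  by move=> t _; rewrite lee_fin; exact: stage_cost_ge0.
apply: eq_eseriesr => t _; rewrite -EFinM; congr (_%:E).
by rewrite stateZ !stage_costE /= !qfZ mulrDr.
Qed.

Lemma cost_shift x v :
  cost x v = ((stage_cost Q R x (v 0%N))%:E
              + cost (A *m x + B *m v 0%N)%R (fun s => v s.+1))%E.
Proof.
rewrite {1}/lqr_cost nneseries_recl //; last first.
  by move=> t _; rewrite lee_fin; exact: stage_cost_ge0.
congr (_ + _)%E; rewrite -nneseries_addn; last first.
  by move=> t; rewrite lee_fin; exact: stage_cost_ge0.
by apply: eq_eseriesr => t _; rewrite addn1 state_shift.
Qed.

(** By [complete_square], each stage cost plus the increment of [qf P] along the state is a value of
    the form of the weight, nonnegative by [dare_weight_ge0]. *)
Lemma dare_partial_cost P x v N : dare_solution A B Q R P ->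
  qf P x <= \sum_(t < N) stage_cost Q R (state x v t) (v t)
            + qf P (state x v N).
Proof.
move=> dP; elim: N => [|N IH]; first by rewrite big_ord0 add0r.
apply: le_trans IH _; rewrite big_ord_recr -addrA lerD2l /=.
have /dare_solutionE[symP uS ric] := dP.
rewrite (complete_square A Q hR (state x v N) (v N) symP uS) -ric lerDl.
exact: (dare_weight_ge0 hQ hR _ dP).
Qed.

(** The terminal term of [dare_partial_cost] vanishes in the limit because the state tends to 0.
    This is what makes the value function dominate all Riccati solutions. *)
Lemma dare_le_cost P x v c : dare_solution A B Q R P ->
  admissible x v -> (cost x v <= c%:E)%E -> qf P x <= c.
Proof.
move=> dP xv le_c; rewrite -subr_le0; have c0 := cvg_qf0 P xv.
have <- := cvg_lim (@Rhausdorff F) c0.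
apply: limr_ge; first exact: cvgP c0.
near=> N; rewrite lerBlDl; apply: le_trans (dare_partial_cost x v N dP) _.
by rewrite lerD2r -lee_fin; exact: le_trans (partial_cost_le x v N) le_c.
Unshelve. all: by end_near. Qed.

End Cost.

(** * From LQR solvability to the largest Riccati solution *)

Section Optimal.
Variables (F : realType) (n m : nat).
Variables (A : 'M[F]_n) (B : 'M[F]_(n, m)) (Q : 'M[F]_n) (R : 'M[F]_m).
Hypotheses (hQ : possemidefmx Q) (hR : posdefmx R).
Implicit Types (P : 'M[F]_n) (x y : 'cV[F]_n) (v w : nat -> 'cV[F]_m).

Local Notation state := (state_seq A B).
Local Notation cost := (lqr_cost A B Q R).
Local Notation admissible x u := (state x u @ \oo --> (0 : 'cV[F]_n)).

(** Polarization turns convergence of the values into convergence of the entries, and it dictates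
    the limit matrix. *)
Lemma qf_limit (PN : nat -> 'M[F]_n) (V : 'cV[F]_n -> F) :
  (forall N, (PN N)^T = PN N) ->
  (forall x, qf (PN N) x @[N --> \oo] --> V x) ->
  exists2 P, P^T = P & forall x, V x = qf P x.
Proof.
move=> symPN PNV.
pose d i : 'cV[F]_n := delta_mx i 0.
pose P : 'M[F]_n := \matrix_(i, j) (2^-1 * (V (d i + d j) - V (d i) - V (d j))).
have cvP : PN @ \oo --> P.
  apply/cvg_mxP => i j; rewrite mxE.
  have -> : (fun N => PN N i j) = fun N =>
      2^-1 * (qf (PN N) (d i + d j) - qf (PN N) (d i) - qf (PN N) (d j)).
    apply/funext => N; rewrite qfD // bf_delta.
    by rewrite mulr2n; field.
  by apply: cvgMl_tmp; apply: cvgB => //; apply: cvgB.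
exists P.
  apply/matrixP => i j; rewrite !mxE.
  by congr (_ * _); rewrite addrAC [d i + _]addrC.
move=> x.
have limP : qf (PN N) x @[N --> \oo] --> qf P x.
  by apply: cvg_bf => //; exact: cvg_cst.
by rewrite -(cvg_lim (@Rhausdorff F) limP); apply/esym/cvg_lim.
Qed.

(** * Optimal inputs [us] and value function [V] of a solvable problem *)

Section Solvable.
Variables (us : 'cV[F]_n -> nat -> 'cV[F]_m) (V : 'cV[F]_n -> F).
Hypothesis us_adm : forall x, admissible x (us x).
Hypothesis us_cost : forall x, cost x (us x) = (V x)%:E.
Hypothesis V_le : forall x v, admissible x v -> ((V x)%:E <= cost x v)%E.

Lemma value_ge0 x : 0 <= V x.
Proof. by rewrite -lee_fin -us_cost; exact: cost_ge0. Qed.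

Lemma value_scale_ge c x : c ^+ 2 * V x <= V (c *: x).
Proof.
have [->|c0] := eqVneq c 0; first by rewrite expr0n mul0r value_ge0.
have adm : admissible x (c^-1 \*: us (c *: x)).
  have := admissibleZ c^-1 (us_adm (c *: x)).
  by rewrite scalerA mulVf // scale1r.
have := V_le adm; rewrite -{2}[x]scale1r -(mulVf c0) -scalerA.
rewrite cost_scale // us_cost -EFinM lee_fin => le1.
have c2 : 0 < c ^+ 2 by rewrite exprn_even_gt0.
by rewrite -ler_pdivlMl // -exprVn.
Qed.

Lemma value_double_ge x : 4 * V x <= V (x + x).
Proof.
have := value_scale_ge 2 x; rewrite scaler_nat mulr2n.
by congr (_ * _ <= _); rewrite expr2; ring.
Qed.

Lemma sum_cost_fin (a b : \bar F) (r : F) : (0 <= a)%E -> (0 <= b)%E ->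
  (a + b = r%:E)%E -> exists a' b', [/\ a = a'%:E, b = b'%:E & a' + b' = r].
Proof.
case: a => [a||] //; case: b => [b||] // _ _ [ab].
by exists a, b.
Qed.

Lemma value_parallelogram_ge x y :
  V x + V x + (V y + V y) <= V (x + y) + V (x - y).
Proof.
have ax := admissibleD (us_adm (x + y)) (us_adm (x - y)).
have ay := admissibleB (us_adm (x + y)) (us_adm (x - y)).
have := cost_parallelogram A B hQ hR (x + y) (x - y) (us (x + y)) (us (x - y)).
have dx : x + y + (x - y) = x + x by rewrite addrACA subrr addr0.
have dy : x + y - (x - y) = y + y.
  by rewrite opprB [y - x]addrC addrACA subrr add0r.
rewrite !us_cost -!EFinD => /sum_cost_fin[||a [b [ea eb ab]]];
  try exact: cost_ge0.
have := V_le ax; have := V_le ay; rewrite ea eb !lee_fin dx dy.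
have := value_double_ge x; have := value_double_ge y; lra.
Qed.

(** In the parallelogram identity for [v] and [us x], the sum steers [x + x] and costs at least
    [4 * V x]. Nothing is left for the difference, whose inputs vanish since [R] is positive
    definite. *)
Lemma optimal_unique x v :
  admissible x v -> (cost x v <= (V x)%:E)%E -> v = us x.
Proof.
move=> xv le_V; apply/funext => t.
have costE : cost x v = (V x)%:E by apply/eqP; rewrite eq_le le_V V_le.
have := cost_parallelogram A B hQ hR x x v (us x).
rewrite !us_cost costE -!EFinD => /sum_cost_fin[||a [b [ea eb ab]]];
  try exact: cost_ge0.
have := V_le (admissibleD xv (us_adm x)); rewrite ea lee_fin => le_a.
have := value_double_ge x => le_2.
have b0 : b <= 0 by lra.
have := partial_cost_le A B hQ hR (x - x) (v \- us x) t.+1.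
rewrite eb lee_fin big_ord_recr /= => le_b.
apply/eqP; rewrite -subr_eq0; apply/eqP/(posdef_eq0 hR).
apply: le_trans b0; apply: le_trans le_b; rewrite stage_costE addrA lerDr.
rewrite addr_ge0 ?sumr_ge0 //; first by move=> i _; exact: stage_cost_ge0.
by case: hQ => _; apply.
Qed.

(** The difference of the two inputs costs at least [V (x - y)], so the parallelogram identity
    bounds the cost of the sum by [V (x + y)]; uniqueness concludes. *)
Lemma optimal_additive x y : us (x + y) = us x \+ us y.
Proof.
apply/esym/optimal_unique; first exact: admissibleD.
have := cost_parallelogram A B hQ hR x y (us x) (us y).
rewrite !us_cost -!EFinD => /sum_cost_fin[||a [b [-> eb ab]]];
  try exact: cost_ge0.
have := V_le (admissibleB (us_adm x) (us_adm y)); rewrite eb !lee_fin => le_b.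
have := value_parallelogram_ge x y; lra.
Qed.

Lemma optimal_scale c x : us (c *: x) = c \*: us x.
Proof.
apply/esym/optimal_unique; first exact: admissibleZ.
by rewrite cost_scale // us_cost -EFinM lee_fin value_scale_ge.
Qed.

Let K : 'M[F]_(m, n) := \matrix_(i, j) us (delta_mx j 0) 0%N i 0.
Let M := A + B *m K.

Lemma optimal_feedback x : us x 0%N = K *m x.
Proof.
have us_sum (r : seq 'I_n) (c : 'I_n -> F) :
  us (\sum_(j <- r) c j *: delta_mx j 0) 0%N
  = \sum_(j <- r) c j *: us (delta_mx j 0) 0%N.
  elim: r => [|j r IH].
    by rewrite !big_nil -(scale0r 0) optimal_scale /= scale0r.
  by rewrite !big_cons optimal_additive /= optimal_scale IH.
rewrite {1}[x]matrix_sum_delta; under eq_bigr do rewrite big_ord1.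
rewrite us_sum; apply/matrixP => i j; rewrite (ord1 j) summxE mxE.
by apply: eq_bigr => k _; rewrite !mxE mulrC.
Qed.

(** Principle of optimality: gluing the first optimal input to an optimal continuation cannot beat
    [us x], so the tail of [us x] is optimal, and it is unique. *)
Lemma optimal_shift x : (fun t => us x t.+1) = us (M *m x).
Proof.
have nextx : A *m x + B *m us x 0%N = M *m x.
  by rewrite optimal_feedback mulmxA -mulmxDl.
apply: optimal_unique.
  by have /admissible_shift := us_adm x; rewrite nextx.
pose w t := if t is s.+1 then us (M *m x) s else us x 0%N.
have xw : admissible x w.
  by apply/admissible_shift; rewrite /= nextx; exact: us_adm.
have := V_le xw; rewrite -us_cost !(cost_shift _ _ hQ hR x) /= nextx us_cost.
by rewrite leeD2lE.
Qed.

Lemma optimal_state x t : state x (us x) t = M ^+ t *m x.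
Proof.
elim: t x => [|t IH] x; first by rewrite expr0 mul1mx.
rewrite state_shift optimal_shift optimal_feedback mulmxA -mulmxDl IH.
by rewrite exprSr -mulmxE mulmxA.
Qed.

Lemma optimal_input x t : us x t = K *m state x (us x) t.
Proof.
elim: t x => [|t IH] x; first exact: optimal_feedback.
have -> : us x t.+1 = us (M *m x) t by rewrite -optimal_shift.
rewrite IH state_shift optimal_shift optimal_feedback.
by rewrite mulmxA -mulmxDl.
Qed.

Lemma closed_loop_stable : stable M.
Proof.
by move=> x; under eq_fun do rewrite -optimal_state; exact: us_adm.
Qed.

(** Under the linear feedback every partial cost is a quadratic form in the initial state, and [V]
    is their pointwise limit. *)
Lemma value_quadratic : exists2 P, P^T = P & forall x, V x = qf P x.
Proof.
pose W := Q + K^T *m R *m K.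
apply: (@qf_limit (fun N => \sum_(t < N) (M ^+ t)^T *m W *m M ^+ t)).
  move=> N; rewrite linear_sum; apply: eq_bigr => t _ /=.
  rewrite !trmx_mul !trmxK linearD /= !trmx_mul trmxK.
  by case: hQ => -> _; case: hR => -> _; rewrite !mulmxA.
move=> x; have PE N : qf (\sum_(t < N) (M ^+ t)^T *m W *m M ^+ t) x =
    \sum_(t < N) stage_cost Q R (state x (us x) t) (us x t).
  elim: N => [|N IH]; first by rewrite !big_ord0 /qf bf0.
  rewrite !big_ord_recr /= qfMD IH; congr (_ + _).
  rewrite stage_costE optimal_input optimal_state -qf_mul.
  by rewrite qfMD -!qf_mul.
by under eq_fun do rewrite PE; exact: cost_cvg.
Qed.

(** Bellman's equation at [K *m x] and inequality at all other inputs, read through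
    [complete_square], give the gain and the Riccati equation; maximality is [dare_le_cost] along
    optimal inputs. *)
Lemma value_largest_dare : exists2 P, dare_largest_solution A B Q R P &
  K = riccati_gain A B R P.
Proof.
have [P symP VP] := value_quadratic.
have P0 x : 0 <= qf P x by rewrite -VP value_ge0.
have bellman_eq x :
    qf P x = stage_cost Q R x (K *m x) + qf P (A *m x + B *m (K *m x)).
  have := cost_shift A B hQ hR x (us x).
  have nextx : A *m x + B *m (K *m x) = M *m x by rewrite mulmxA -mulmxDl.
  by rewrite optimal_shift optimal_feedback nextx !us_cost -EFinD !VP => -[].
have bellman_le x (v : 'cV[F]_m) :
    qf P x <= stage_cost Q R x v + qf P (A *m x + B *m v).
  pose w t := if t is s.+1 then us (A *m x + B *m v) s else v.
  have xw : admissible x w by apply/admissible_shift; exact: us_adm.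
  have := V_le xw; rewrite (cost_shift _ _ hQ hR) /= us_cost -EFinD lee_fin.
  by rewrite !VP.
have pS : posdefmx (riccati_weight B R P) by exact: riccati_weight_posdef.
have uS := posdef_unit pS.
have KE : K = riccati_gain A B R P.
  apply/eqP; rewrite -subr_eq0; apply/eqP/matrixP => i j.
  rewrite [RHS]mxE; pose x : 'cV[F]_n := delta_mx j 0.
  suff /matrixP/(_ i 0) : (K - riccati_gain A B R P) *m x = 0.
    by rewrite -colE !mxE.
  apply: (posdef_eq0 pS); rewrite mulmxBl.
  (* The Riccati gain minimizes the completed square; testing it leaves a nonpositive value of the
     weight form at the difference of the two inputs. *)
  have := bellman_le x (riccati_gain A B R P *m x).
  have := bellman_eq x; rewrite !(complete_square A Q hR x _ symP uS).
  by rewrite subrr qf0 => ->; rewrite addr0 gerDl.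
exists P => //; split.
  apply/dare_solutionE; split => //.
  apply: sym_qf_eq => [//||x]; first exact: riccati_map_sym.
  rewrite bellman_eq (complete_square A Q hR x _ symP uS) KE.
  by rewrite subrr qf0 addr0.
move=> P' dP'; have [symP' _ _] := dP'.
split=> [|x]; first by rewrite linearB /= symP symP'.
rewrite -/(bf _ _ _) -/(qf _ _) qfMB subr_ge0 -VP.
by apply: (dare_le_cost hQ hR dP' (us_adm x)); rewrite us_cost.
Qed.

End Solvable.

Lemma lqr_solvable_gain : lqr_solvable A B Q R ->
  exists2 P, dare_largest_solution A B Q R P &
    stable (A + B *m riccati_gain A B R P).
Proof.
move=> /choice[us usP].
have us_adm x : admissible x (us x) by have [] := usP x.
pose V x := fine (cost x (us x)).
have us_cost x : cost x (us x) = (V x)%:E.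
  rewrite fineK // ge0_fin_numE; last exact: cost_ge0.
  by have [] := usP x.
have V_le x v : admissible x v -> ((V x)%:E <= cost x v)%E.
  by move=> xv; rewrite -us_cost; have [_ _] := usP x; apply.
have [P dP KE] := value_largest_dare us_adm us_cost V_le.
by exists P => //; rewrite -KE; exact: closed_loop_stable us_cost V_le.
Qed.

Lemma dare_largest_unique P P' : dare_largest_solution A B Q R P ->
  dare_largest_solution A B Q R P' -> P = P'.
Proof.
move=> [dP maxP] [dP' maxP'].
have [symP _ _] := dP; have [symP' _ _] := dP'.
by apply: possemidef_antisym => //; [exact: maxP | exact: maxP'].
Qed.

End Optimal.

(** * Stability and the Lyapunov matrix inequality *)

Section Lyapunov.
Variables (F : realType) (n : nat).
Implicit Types A Y : 'M[F]_n.

Lemma qf_block k l (M1 : 'M[F]_k) (X1 : 'M[F]_(k, l)) X2 (M2 : 'M[F]_l) a b :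
  qf (block_mx M1 X1 X2 M2) (col_mx a b) =
  qf M1 a + bf X1 a b + bf X2 b a + qf M2 b.
Proof.
rewrite /qf /bf tr_col_mx mul_row_block mul_row_col !mulmxDl !mxE.
by ring.
Qed.

Lemma posdef_block_ul k l (M1 : 'M[F]_k) (X1 : 'M[F]_(k, l)) X2 (M2 : 'M[F]_l) :
  posdefmx (block_mx M1 X1 X2 M2) -> posdefmx M1.
Proof.
move=> [symM posM]; split=> [|v v0].
  by move: symM; rewrite tr_block_mx => /eq_block_mx[].
 have := posM (col_mx v 0).
rewrite col_mx_eq0 negb_and v0 -/(bf _ _ _) -/(qf _ _) qf_block qf0.
by rewrite -(scale0r 0) bfZr bfZl !mul0r !addr0; apply.
Qed.

(** The Schur complement [N] is the decrease of [qf Y] along [A^T]. A nonincreasing sequence bounded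
    below has vanishing decrements, so [A^T], hence [A], is stable. *)
Lemma lyapunov_lmi_stable A Y :
  posdefmx (block_mx Y (A *m Y) (A *m Y)^T Y) -> stable A.
Proof.
move=> [symL posL].
have pY : posdefmx Y by apply: posdef_block_ul (conj symL posL).
have [symY _] := pY.
have qfL a b : qf (block_mx Y (A *m Y) (A *m Y)^T Y) (col_mx a b) =
    qf Y a + bf (A *m Y) a b *+ 2 + qf Y b.
  by rewrite qf_block bf_tr mulr2n addrA.
pose N := Y - A *m Y *m A^T.
have NE w : qf N w = qf Y w - qf Y (A^T *m w).
  by rewrite qfMB [qf Y (_ *m _)]qf_mul trmxK.
have pN : posdefmx N.
  split=> [|v v0]; first by rewrite linearB /= !trmx_mul trmxK symY mulmxA.
  (* The second component minimizes the block form for a given first component [v], leaving the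
     Schur complement. *)
  have := posL (col_mx v (- (A^T *m v))).
  rewrite col_mx_eq0 negb_and v0 -/(bf _ _ _) -/(qf _ _) qfL qfN bfNr bf_mulr.
  have -> : bf (A *m Y *m A^T) v v = qf Y (A^T *m v) by rewrite qf_mul trmxK.
  move=> /(_ isT); rewrite -/(bf N v v) -/(qf N v) NE mulr2n; lra.
rewrite -[A]trmxK; apply: stable_tr => w.
apply: (posdef_cvg0 pN).
pose f t := qf Y (A^T ^+ t *m w).
have fE t : qf N (A^T ^+ t *m w) = f t - f t.+1.
  by rewrite NE /f exprS -mulmxE mulmxA.
under eq_fun do rewrite fE.
have cvf : cvgn f.
  apply: nonincreasing_is_cvgn.
    apply/nonincreasing_seqP => t; rewrite -subr_ge0 -fE.
    exact: posdef_ge0.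
  by exists 0 => _ [t _ <-]; exact: posdef_ge0.
suff : f t - f t.+1 @[t --> \oo] --> limn f - limn f by rewrite subrr.
by apply: cvgB => //; rewrite (cvg_shiftS f).
Qed.

Lemma posdef_lyapunov_lmi A Y : posdefmx Y -> posdefmx (Y - A *m Y *m A^T) ->
  posdefmx (block_mx Y (A *m Y) (A *m Y)^T Y).
Proof.
move=> pY pN; have [symY _] := pY.
split=> [|v]; first by rewrite tr_block_mx trmxK symY.
rewrite -[v]vsubmxK; set a := usubmx v; set b := dsubmx v.
have -> : ((col_mx a b)^T *m block_mx Y (A *m Y) (A *m Y)^T Y *m col_mx a b) 0 0
    = qf (Y - A *m Y *m A^T) a + qf Y (b + A^T *m a).
  rewrite -/(bf _ _ _) -/(qf _ _) qf_block bf_tr qfD // qfMB.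
  rewrite [qf Y (_ *m _)]qf_mul trmxK -[bf Y b _]bf_tr symY.
  rewrite [bf Y (_ *m _) b]/bf trmx_mul trmxK -!mulmxA.
  by rewrite [bf _ a b]/bf -!mulmxA; ring.
rewrite col_mx_eq0 negb_and; have [a0|a0 _] := eqVneq a 0.
  by rewrite a0 mulmx0 addr0 qf0 add0r /=; case: pY => _; apply.
by rewrite ltr_pwDl ?posdef_ge0 //; case: pN => _; apply.
Qed.

(** Cauchy-Schwarz in each coordinate; the constant is the squared Frobenius norm of [C]. *)
Lemma qf1_mul_le (C : 'M[F]_n) w :
  qf 1%:M (C^T *m w) <= (\sum_i qf 1%:M (C *m delta_mx i 0)) * qf 1%:M w.
Proof.
rewrite [leLHS]qf1E big_distrl; apply: ler_sum => i _ /=.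
have -> : (C^T *m w) i 0 = bf 1%:M (C *m delta_mx i 0) w.
  by rewrite /bf mulmx1 trmx_mul trmx_delta -mulmxA -rowE [RHS]mxE.
by apply: psd_cauchy; split=> [|v]; [exact: trmx1 | exact: qf1_ge0].
Qed.

(* For Y = \sum_(t < N) A^t (A^t)^T, telescoping gives
   Y - A Y A^T = I - A^N (A^N)^T, positive definite for N large. *)
Lemma stable_lyapunov_lmi A : stable A ->
  exists Y, posdefmx (block_mx Y (A *m Y) (A *m Y)^T Y).
Proof.
move=> stA; pose g N := \sum_i qf 1%:M (A ^+ N *m delta_mx i (0 : 'I_1)).
have g0 : g N @[N --> \oo] --> (0 : F).
  rewrite [X in _ --> X](_ : 0 = \sum_(i < n) 0); last by rewrite big1.
  by apply: cvg_sum_fin => i; apply: cvg_qf0.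
have [N0 _ gN] := (cvgrPdist_lt _ _).1 g0 _ ltr01.
have {gN} gN := gN N0.+1 (leqnSn N0).
(* Taking a successor ensures that the sum contains the term [t = 0], the identity, which makes [Y]
   positive definite. *)
pose N := N0.+1; pose Y := \sum_(t < N) A ^+ t *m (A ^+ t)^T.
have YE k w : qf (\sum_(t < k) A ^+ t *m (A ^+ t)^T) w =
    \sum_(t < k) qf 1%:M ((A ^+ t)^T *m w).
  elim: k => [|k IH]; first by rewrite !big_ord0 /qf bf0.
  by rewrite !big_ord_recr /= qfMD IH [in RHS]qf_mul trmxK mulmx1.
exists Y; apply: posdef_lyapunov_lmi.
  split=> [|w w0].
    by rewrite linear_sum; apply: eq_bigr => t _; rewrite /= trmx_mul trmxK.
  rewrite -/(bf _ _ _) -/(qf _ _) YE big_ord_recl expr0 trmx1 mul1mx.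
  by rewrite ltr_pwDl ?qf1_gt0 // sumr_ge0 // => t _; exact: qf1_ge0.
have -> : Y - A *m Y *m A^T = 1%:M - A ^+ N *m (A ^+ N)^T.
  rewrite mulmx_sumr mulmx_suml.
  rewrite (eq_bigr (fun t : 'I_N => A ^+ t.+1 *m (A ^+ t.+1)^T)); last first.
    by move=> t _; rewrite exprS -mulmxE trmx_mul !mulmxA.
  rewrite /Y big_ord_recl [in X in _ - X]big_ord_recr /= expr0 mul1mx trmx1.
  by rewrite opprD addrA; congr (_ - _); rewrite addrK.
split=> [|w w0]; first by rewrite linearB /= trmx1 trmx_mul trmxK.
rewrite -/(bf _ _ _) -/(qf _ _) qfMB subr_gt0.
have -> : qf (A ^+ N *m (A ^+ N)^T) w = qf 1%:M ((A ^+ N)^T *m w).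
  by rewrite qf_mul trmxK mulmx1.
apply: le_lt_trans (qf1_mul_le _ _) _; rewrite gtr_pMl ?qf1_gt0 //.
by move: gN; rewrite sub0r normrN; exact: le_lt_trans (ler_norm _).
Qed.

End Lyapunov.

(** * Systems for which the zero input is optimal *)

Section ZeroGain.
Variables (F : realType) (n m : nat).
Variables (A : 'M[F]_n) (B : 'M[F]_(n, m)) (Q : 'M[F]_n) (R : 'M[F]_m).
Hypotheses (hQ : possemidefmx Q) (hR : posdefmx R).

(** As [Q *m A = 0], the zero input pays only [qf Q x] at time 0, a cost that no input avoids. Thus
    the value function is [qf Q], and [Q] is the largest Riccati solution. *)
Lemma zero_gain_optimal : stable A -> Q *m A = 0 -> Sigma_K Q R 0 (A, B).
Proof.
move=> stA QA0; pose u0 (_ : nat) : 'cV[F]_m := 0.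
have stateE x t : state_seq A B x u0 t = A ^+ t *m x.
  elim: t => [|t /= ->]; first by rewrite expr0 mul1mx.
  by rewrite mulmx0 addr0 exprS -mulmxE mulmxA.
have adm x : state_seq A B x u0 @ \oo --> (0 : 'cV[F]_n).
  by rewrite (_ : state_seq A B x u0 = fun t => A ^+ t *m x) //; apply/funext.
have costE x : lqr_cost A B Q R x u0 = (qf Q x)%:E.
  rewrite (cost_shift A B hQ hR) stage_costE qf0 addr0.
  rewrite [X in (_ + X)%E](_ : _ = 0%E) ?adde0 // /lqr_cost.
  apply: eseries0 => t _ _; rewrite -state_shift stateE stage_costE qf0 addr0.
  by rewrite exprS -mulmxE -mulmxA /qf bf_mulr QA0 bf0.
have le_cost x v : ((qf Q x)%:E <= lqr_cost A B Q R x v)%E.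
  apply: le_trans (partial_cost_le A B hQ hR x v 1).
  rewrite big_ord1 lee_fin stage_costE lerDl /=.
  exact: posdef_ge0.
have [symQ Q0] := hQ.
have gain0 : riccati_gain A B R Q = 0.
  by rewrite /riccati_gain -!mulmxA QA0 !mulmx0 oppr0.
split=> /=.
  move=> x; exists u0; split=> [||v _]; rewrite ?costE ?ltry //.
exists Q; split; last by rewrite -[LHS]gain0.
split.
  apply/dare_solutionE; split=> //.
    exact/posdef_unit/riccati_weight_posdef.
  by rewrite /riccati_map -!mulmxA QA0 !mulmx0 subr0 add0r.
move=> P dP; have [symP _ _] := dP.
split=> [|x]; first by rewrite linearB /= symP symQ.
rewrite -/(bf _ _ _) -/(qf _ _) qfMB subr_ge0.
by apply: (dare_le_cost hQ hR dP (adm x)); rewrite costE.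
Qed.

End ZeroGain.

(** * Consequences of a common optimal gain for all consistent systems *)

Section Consistent.
Variables (F : realType) (n m T : nat).
Variables (Z : 'M[F]_(n + m, T)) (Xp : 'M[F]_(n, T)).
Variables (As : 'M[F]_n) (Bs : 'M[F]_(n, m)).
Hypothesis data : Xp = row_mx As Bs *m Z.

Let Sigma : set ('M[F]_n * 'M[F]_(n, m)) :=
  [set AB | Xp = row_mx AB.1 AB.2 *m Z].

Lemma consistent_perturb (e : 'cV[F]_n) (a : 'rV[F]_n) (b : 'rV[F]_m) :
  row_mx a b *m Z = 0 ->
  Sigma (As + e *m a, Bs + e *m b).
Proof.
move=> ab0; rewrite /Sigma /= data -add_row_mx mulmxDl -mul_mx_row -mulmxA.
by rewrite ab0 mulmx0 addr0.
Qed.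

(** A row in the left kernel of [Z] can be added to row [i0] of the true system, which is where
    [0 < n] enters: for [n = 0] the set is a singleton whatever [Z] is. *)
Lemma identifiableP : (0 < n)%N -> Sigma = [set (As, Bs)] <-> row_free Z.
Proof.
move=> hn; split=> [sing|freeZ]; last first.
  apply/seteqP; split=> [[A B]|_ ->] //= eqX.
  have /eq_row_mx[-> ->] // : row_mx A B = row_mx As Bs.
  by apply: (row_free_inj freeZ); rewrite -eqX.
apply: inj_row_free => r; rewrite -[r]hsubmxK; set a := lsubmx r.
set b := rsubmx r => rZ0; pose i0 := Ordinal hn.
have := consistent_perturb (delta_mx i0 0) rZ0; rewrite sing /= => -[ea eb].
have zero k (c : 'rV[F]_k) (C : 'M[F]_(n, k)) :
    C + delta_mx i0 0 *m c = C -> c = 0.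
  move=> /(canRL (addKr _)); rewrite addNr => /matrixP dc0.
  apply/matrixP => i j; have := dc0 i0 j.
  by rewrite mxE big_ord1 !mxE !eqxx mul1r (ord1 i).
by rewrite (zero _ _ _ ea) (zero _ _ _ eb) row_mx0.
Qed.

Variables (Q : 'M[F]_n) (R : 'M[F]_m) (K : 'M[F]_(m, n)).
Hypotheses (hQ : possemidefmx Q) (hR : posdefmx R).
Hypothesis optK : Sigma `<=` Sigma_K Q R K.

(** Uniqueness of the largest solution identifies the one defining [K] with the one obtained from
    solvability, whose closed loop is known to be stable. *)
Lemma consistent_dare A B : Sigma (A, B) -> exists P,
  [/\ dare_solution A B Q R P, K = riccati_gain A B R P & stable (A + B *m K)].
Proof.
move=> /optK[/= /(lqr_solvable_gain hQ hR)[P lP stP] [P' [lP' KE]]].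
have PP' := dare_largest_unique lP lP'; rewrite -PP' in KE.
by exists P; split; [case: lP | | rewrite KE].
Qed.

Lemma closed_loop_perturb (e : 'cV[F]_n) (a : 'rV[F]_n) (b : 'rV[F]_m) :
  As + e *m a + (Bs + e *m b) *m K = As + Bs *m K + e *m (a + b *m K).
Proof. by rewrite mulmxDl -mulmxA addrACA -mulmxDr. Qed.

Lemma kernel_gain (a : 'rV[F]_n) (b : 'rV[F]_m) :
  row_mx a b *m Z = 0 -> a + b *m K = 0.
Proof.
move=> ab0; apply/eqP; apply: contraT => r0; exfalso.
set r := a + b *m K in r0; pose M := As + Bs *m K.
have rt0 : r^T != 0 by rewrite -trmx0 (inj_eq trmx_inj).
have N0 := qf1_gt0 rt0; pose v := (qf 1%:M r^T)^-1 *: r^T.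
have rv : r *m v = 1%:M.
  rewrite -scalemxAr; apply/matrixP => i j; rewrite !ord1 mxE [RHS]mxE.
  have -> : (r *m r^T) 0 0 = qf 1%:M r^T by rewrite /qf /bf mulmx1 trmxK.
  by rewrite mulVf // gt_eqF.
(* Since [r *m v = 1], this perturbation makes the closed loop [M + e r] send [v] to [2 v]. *)
have [P [_ _ stP]] :=
  consistent_dare (consistent_perturb (v *+ 2 - M *m v) ab0).
have v0 : v = 0.
  apply: (unstable_double stP).
  rewrite closed_loop_perturb -/M -/r mulmxDl -mulmxA rv mulmx1.
  by rewrite addrC subrK.
have /matrixP/(_ 0 0) := rv; rewrite v0 mulmx0 !mxE => /eqP.
by rewrite eq_sym oner_eq0.
Qed.

Lemma unidentifiable_zero_gain (a : 'rV[F]_n) (b : 'rV[F]_m) :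
  row_mx a b *m Z = 0 -> row_mx a b != 0 ->
  [/\ K = 0, Q *m As = 0 & stable As].
Proof.
move=> ab0 abn0; have abK := kernel_gain ab0; pose M := As + Bs *m K.
have bn0 : b != 0.
  apply: contraNneq abn0 => b0; move: abK.
  by rewrite b0 mul0mx addr0 => ->; rewrite row_mx0.
have loop e : (As + e *m a) + (Bs + e *m b) *m K = M.
  by rewrite closed_loop_perturb abK mulmx0 addr0.
have [P [dP KE stM]] := consistent_dare data.
have /dare_solutionE[symP uS ric] := dP.
have bellman A B P' : dare_solution A B Q R P' -> K = riccati_gain A B R P' ->
    forall x, qf P' x = stage_cost Q R x (K *m x) + qf P' ((A + B *m K) *m x).
  move=> /dare_solutionE[symP' uS' ric'] KE' x; rewrite mulmxDl -mulmxA.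
  by rewrite (complete_square A Q hR x _ symP' uS') -ric' KE' subrr qf0 addr0.
have PM0 : P *m M = 0.
  have {}PM0 (e : 'cV[F]_n) : (e *m b)^T *m P *m M = 0.
    have [P' [dP' KE' _]] := consistent_dare (consistent_perturb e ab0).
    have /dare_solutionE[symP' uS' _] := dP'.
    have PP' : P' = P.
      (* Gain and closed loop being shared, the two Bellman equations have the same stage costs, so
         the difference of the forms is invariant under [M]. *)
      apply: sym_qf_eq => // x; apply/eqP; rewrite -subr_eq0 -qfMB; apply/eqP.
      apply: (stable_invariant_qf stM) => {}x.
      rewrite !qfMB (bellman _ _ _ dP KE x) (bellman _ _ _ dP' KE' x) loop.
      by rewrite opprD addrACA subrr add0r.
    (* The two stationarity conditions differ only by the increment [e *m b] of the input matrix. *)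
    have := riccati_gain_foc As uS; have := riccati_gain_foc (As + e *m a) uS'.
    rewrite -KE' -KE loop PP' [(Bs + _)^T]linearD [_ *m P]mulmxDl.
    rewrite [_ *m M]mulmxDl addrA.
    by rewrite -/M => + foc; rewrite foc add0r.
  have [j bj] : exists j, b 0 j != 0.
    apply/existsP; apply: contraR bn0 => /existsPn bj; apply/eqP/rowP => j.
    by rewrite mxE; apply/eqP; have := bj j; rewrite negbK.
  (* For [e = e_k], entry [(j, l)] of the zero product is [b 0 j] times entry [(k, l)] of
     [P *m M]. *)
  apply/matrixP => k l; have /matrixP/(_ j l) := PM0 (delta_mx k 0).
  rewrite -mulmxA trmx_mul trmx_delta -mulmxA -rowE !mxE big_ord1 !mxE.
  by move=> /eqP; rewrite mulf_eq0 (negPf bj) => /eqP.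
have K0 : K = 0.
  have := riccati_gain_foc As uS; rewrite -KE -/M -mulmxA PM0 mulmx0 addr0.
  by move=> RK; rewrite -[K](mulKmx (posdef_unit hR)) RK mulmx0.
have MA : M = As by rewrite /M K0 mulmx0 addr0.
split=> //; last by rewrite -MA.
(* [Q] equals [P]: with [K = 0] and [P *m M = 0], Bellman's equation reads [qf P x = qf Q x]. *)
rewrite -MA -PM0; congr (_ *m _); apply: sym_qf_eq => //; first by case: hQ.
move=> x; rewrite (bellman _ _ _ dP KE) -/M stage_costE K0 mul0mx qf0 addr0.
by rewrite /qf bf_mulr PM0 bf0 addr0.
Qed.

(** By [kernel_gain] with [K = 0], every left kernel row [[a b]] of [Z] has [a = 0]. By duality the
    columns of [[I; 0]] then lie in the column space of [Z]. *)
Lemma zero_gain_state_inverse : K = 0 ->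
  exists G : 'M[F]_(T, n), Z *m G = col_mx 1%:M 0.
Proof.
move=> K0; have /submxP[D DE] : (row_mx 1%:M (0 : 'M[F]_(n, m)) <= Z^T)%MS.
  rewrite submxE; have := mulmx_coker Z^T; move: (cokermx _) => C ZC.
  apply/eqP/matrixP => i j; have colZ : (col j C)^T *m Z = 0.
    apply: trmx_inj; rewrite trmx_mul trmxK trmx0 colE mulmxA.
    by rewrite ZC mul0mx.
  rewrite -[X in X *m Z]hsubmxK in colZ; have := kernel_gain colZ.
  rewrite K0 mulmx0 addr0 => /matrixP/(_ 0 i); rewrite !mxE => Cij.
  rewrite (bigD1 (lshift m i)) //= row_mxEl mxE eqxx mul1r Cij add0r big1 //.
  move=> k; rewrite -[k]splitK; case: (fintype.split k) => k' /= ne.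
    rewrite row_mxEl mxE (_ : i == k' = false) ?mul0r //.
    by apply: contraNF ne => /eqP ->.
  by rewrite row_mxEr mxE mul0r.
exists D^T; apply: trmx_inj.
by rewrite trmx_mul trmxK -DE tr_col_mx trmx1 trmx0.
Qed.

End Consistent.

(** * The data matrices and the characterization of informativity *)

Lemma data_consistent (F : realType) (n m q : nat) (Ts : 'I_q -> nat)
    (u : forall i : 'I_q, 'I_(Ts i) -> 'cV[F]_m)
    (x : forall i : 'I_q, 'I_(Ts i).+1 -> 'cV[F]_n) A B :
  data_generated_by u x A B ->
  Xplus x = row_mx A B *m col_mx (Xminus x) (Uminus u).
Proof.
move=> dat; rewrite mul_row_col !mul_mxrow -mxrowD; apply: eq_mxrow => i.
apply/matrixP => k t; rewrite !mxE dat !mxE.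
by congr (_ + _); apply: eq_bigr => j _; rewrite mxE.
Qed.

Theorem theorem28 (F : realType) (n m q : nat) (Ts : 'I_q -> nat)
    (hn : (0 < n)%N) (hm : (0 < m)%N) (hq : (0 < q)%N)
    (hTs : forall i : 'I_q, (0 < Ts i)%N)
    (As : 'M[F]_n) (Bs : 'M[F]_(n, m))
    (u : forall i : 'I_q, 'I_(Ts i) -> 'cV[F]_m)
    (x : forall i : 'I_q, 'I_(Ts i).+1 -> 'cV[F]_n)
    (hdata : data_generated_by u x As Bs)
    (Q : 'M[F]_n) (R : 'M[F]_m)
    (hQ : possemidefmx Q) (hR : posdefmx R) :
  let Um := Uminus u in
  let Xm := Xminus x in
  let Xp := Xplus x in
  let T := (\sum_(i < q) Ts i)%N in
  let right_inverse (V1 : 'M[F]_(T, n)) (V2 : 'M[F]_(T, m)) :=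
    col_mx Xm Um *m row_mx V1 V2 = block_mx 1%:M 0 0 1%:M in
  [/\ informative_lqr u x Q R <->
        (informative_sysid u x As Bs /\ lqr_solvable As Bs Q R) \/
        (exists Theta : 'M[F]_(T, n),
          [/\ Xm *m Theta = (Xm *m Theta)^T,
              Um *m Theta = 0,
              posdefmx (block_mx (Xm *m Theta) (Xp *m Theta)
                                 (Theta^T *m Xp^T) (Xm *m Theta))
            & Q *m Xp *m Theta = 0]),
      informative_sysid u x As Bs <->
        (exists V1 : 'M[F]_(T, n), exists V2 : 'M[F]_(T, m),
          right_inverse V1 V2)
    & forall (V1 : 'M[F]_(T, n)) (V2 : 'M[F]_(T, m)),
        right_inverse V1 V2 -> As = Xp *m V1 /\ Bs = Xp *m V2].
Proof.
move=> Um Xm Xp T right_inverse; set Z := col_mx Xm Um.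
have data : Xp = row_mx As Bs *m Z by exact: data_consistent.
have sysidP : informative_sysid u x As Bs <-> row_free Z.
  exact: identifiableP.
split.
- split=> [[K optK] | [[sysid solv] | [G [symT UT posT QT]]]].
  + have [freeZ|] := pselect (forall r : 'rV_(n + m), r *m Z = 0 -> r = 0).
      left; split; first exact/sysidP/inj_row_free.
      by have [] := optK (As, Bs) data.
    move=> /existsNP[r /not_implyP[rZ0 /eqP rn0]]; right.
    rewrite -[r]hsubmxK in rZ0 rn0.
    have [K0 QA stA] := unidentifiable_zero_gain data hQ hR optK rZ0 rn0.
    have [G ZG] := zero_gain_state_inverse data hQ hR optK K0.
    have [Y posY] := stable_lyapunov_lmi stA.
    have [symY _] := posY.
    have [XG UG] : Xm *m G = 1%:M /\ Um *m G = 0.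
      by move: ZG; rewrite mul_col_mx => /eq_col_mx.
    have XpG : Xp *m G = As.
      by rewrite data -mulmxA ZG mul_row_col mulmx1 mulmx0 addr0.
    (* [G] has [X_- G = I], [U_- G = 0] and [X_+ G = As], so this choice turns the block matrix into
       the Lyapunov inequality for [As] with solution [Y]. *)
    exists (G *m Y); rewrite !mulmxA XG UG XpG -trmx_mul !mulmxA XpG.
    rewrite mul1mx mul0mx -(mulmxA Q) XpG QA mul0mx; split => //.
    by move: symY; rewrite tr_block_mx => /eq_block_mx[].
  + rewrite /informative_sysid in sysid.
    have [P lP _] := lqr_solvable_gain hQ hR solv.
    exists (riccati_gain As Bs R P); rewrite sysid => _ ->.
    by split=> //; exists P.
  (* As [U_- Theta = 0], each consistent [(A, B)] satisfies [X_+ Theta = A (X_- Theta)]: the block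
     inequality is the Lyapunov inequality of every such [A], and the zero gain serves all of
     them. *)
  + exists 0 => -[A B]; rewrite /Sigma_is /= => eqX.
    have XT : Xp *m G = A *m (Xm *m G).
      by rewrite [Xp]eqX mul_row_col mulmxDl -!mulmxA UT mulmx0 addr0.
    move: posT; rewrite -trmx_mul XT => posT.
    have uY := posdef_unit (posdef_block_ul posT).
    apply: zero_gain_optimal => //; first exact: lyapunov_lmi_stable posT.
    by rewrite -[Q *m A](mulmxK uY) -(mulmxA Q) -XT mulmxA QT mul0mx.
- rewrite sysidP; split=> [/row_freeP[V ZV]|[V1 [V2 ZV]]].
    exists (lsubmx V), (rsubmx V).
    by rewrite /right_inverse hsubmxK -scalar_mx_block.
  by apply/row_freeP; exists (row_mx V1 V2); rewrite ZV -scalar_mx_block.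
- move=> V1 V2 ZV; apply/eq_row_mx.
  by rewrite -mul_mx_row data -mulmxA ZV -scalar_mx_block mulmx1.
Qed.
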